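(* Let $d \geq 3$ be an integer and let $\mathbb{T}^d = \mathbb{R}^d/\mathbb{Z}^d$ be the flat $d$-torus. There exists a sequence $(\psi_n)_{n \geq 1}$ of real-valued eigenfunctions of the Laplacian on $\mathbb{T}^d$, with eigenvalues $\lambda_n \to \infty$ as $n \to \infty$, such that for all $1 < p \leq \infty$ the ratio $$\frac{\|\psi_{n,+}\|_p}{\|\psi_{n,-}\|_p}$$ does not tend to $1$ as $n \to \infty$.
   Context: The torus $\mathbb{T}^d=\mathbb{R}^d/\mathbb{Z}^d$ carries the flat metric and volume measure induced from $\mathbb{R}^d$; $\|\cdot\|_p$ denotes the $L^p(\mathbb{T}^d)$ norm with respect to this measure. An eigenfunction of the Laplacian with eigenvalue $\lambda$ is a nonzero smooth function $\psi$ with $-\Delta \psi = \lambda \psi$, where $\Delta = \sum_{i=1}^d \partial_{x_i}^2$. For a real-valued function $\psi$, write $\psi_+ = \psi\,\chi_{\{\psi>0\}}$ and $\psi_- = -\psi\,\chi_{\{\psi<0\}}$, where $\chi_A$ is the indicator function of $A$ (so both are nonnegative); $\psi_{n,\pm}$ means $(\psi_n)_\pm$. *)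

(* Defs.v *)
From HB Require Import structures.
From mathcomp Require Import all_boot all_order all_algebra.
From mathcomp Require Import all_classical all_reals all_analysis.

Set Implicit Arguments.
Unset Strict Implicit.
Unset Printing Implicit Defensive.

Import Order.TTheory GRing.Theory Num.Theory.
Import numFieldNormedType.Exports.

Local Open Scope classical_set_scope.
Local Open Scope ring_scope.

(** A function on the torus R^d / Z^d is a Z^d-periodic function on 'rV[R]_d;
    its integrals are taken over the fundamental domain [0, 1[^d. *)

Section differential.
Context {R : realType} {d : nat}.
Implicit Types (f : 'rV[R]_d -> R) (i : 'I_d).

Definition partial i f : 'rV[R]_d -> R := 'D_'e_i f.

(* [derive] is total, so the existence of every iterated partial derivative
   is required explicitly. *)
Definition smooth f := forall s : seq 'I_d,
  let g := foldr partial f s in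
  continuous g /\ forall i x, derivable g x 'e_i.

Definition laplacian f : 'rV[R]_d -> R :=
  fun x => \sum_(i < d) partial i (partial i f) x.

Definition lattice_periodic f :=
  forall k : 'rV[int]_d, periodic f (map_mx intr k).

Definition torus_eigenfunction (lambda : R) f :=
  [/\ lattice_periodic f, smooth f, exists x, f x != 0 &
      forall x, - laplacian f x = lambda * f x].

End differential.

Section sign_parts.
Context {R : realType} {T : Type}.
Implicit Type f : T -> R.

Definition pos_part f : T -> R := fun x => f x * \1_[set y | 0 < f y] x.

Definition neg_part f : T -> R := fun x => - f x * \1_[set y | f y < 0] x.

End sign_parts.

Section unit_interval.
Context {R : realType}.
Local Open Scope ereal_scope.

Definition unit_interval_measure : set (measurableTypeR R) -> \bar R :=
  mrestr lebesgue_measure (measurable_itv `[0%R, 1%R[).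

HB.instance Definition _ := Measure.on unit_interval_measure.

Let unit_interval_setT : unit_interval_measure [set: _] = 1.
Proof.
by rewrite /unit_interval_measure /mrestr setTI lebesgue_measure_itv/= lte01
  oppr0 adde0.
Qed.

HB.instance Definition _ := @Measure_isProbability.Build _ _ R
  unit_interval_measure unit_interval_setT.

End unit_interval.

Section unit_cube.
Context {R : realType}.
Local Open Scope ereal_scope.

Definition cons_pair n (z : measurableTypeR R * n.-tuple (measurableTypeR R)) :
    n.+1.-tuple (measurableTypeR R) := [the n.+1.-tuple _ of z.1 :: z.2].

Let measurable_cons_pair n : measurable_fun [set: _] (@cons_pair n).
Proof. exact: measurable_cons. Qed.

HB.instance Definition _ n := isMeasurableFun.Build _ _ _ _ (@cons_pair n)
  (@measurable_cons_pair n).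

(* Lebesgue measure on [0, 1[^n, extended by 0 to R^n, as an iterated product
   measure; [unit_cube_measure_box] gives its value on boxes. *)
Fixpoint unit_cube_measure n : probability (n.-tuple (measurableTypeR R)) R :=
  match n with
  | 0%N => \d_[tuple]
  | m.+1 => distribution
      (unit_interval_measure \x unit_cube_measure m) (@cons_pair m)
  end.

Lemma unit_cube_measure_box n (A : 'I_n -> set (measurableTypeR R)) :
  (forall i, measurable (A i)) ->
  unit_cube_measure n [set t | forall i, A i (tnth t i)] =
  \prod_(i < n) lebesgue_measure (A i `&` `[0%R, 1%R[).
Proof.
elim: n A => [|n IHn] A mA.
  by rewrite big_ord0 /= diracE mem_set//= => -[].
rewrite big_ord_recl -IHn// -[X in X * _]/(unit_interval_measure (A ord0)).
rewrite -product_measure1E//; last first.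
  rewrite (_ : [set _ | _] = \bigcap_(i in [set: 'I_n])
      ((@tnth n (measurableTypeR R) ^~ i) @^-1` A (lift ord0 i))).
    apply: fin_bigcap_measurable => // i _; rewrite -[_ @^-1` _]setTI.
    exact: measurable_tnth.
  by apply/seteqP; split => t /= tA i; [move=> _; exact: tA | exact: tA].
rewrite /= /distribution /pushforward; congr (_ _).
apply/seteqP; split => -[x t] /=.
  move=> xtA; split; first exact: (xtA ord0).
  by move=> i; have := xtA (lift ord0 i); rewrite tnthS.
move=> [xA tA] i; have [j ->|->] := unliftP ord0 i; last exact: xA.
by rewrite tnthS; exact: tA.
Qed.

End unit_cube.

Definition torus_Lnorm {R : realType} {d : nat} (p : \bar R)
    (f : 'rV[R]_d -> R) : \bar R :=
  Lnorm (unit_cube_measure d) p (fun t => (f (\row_i tnth t i))%:E).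

(* Main.v *)
Require Import Defs.
From mathcomp Require Import all_boot all_order all_algebra.
From mathcomp Require Import all_classical all_reals all_analysis.
From mathcomp Require Import measurable_realfun ess_sup_inf.
From mathcomp Require Import ring lra.
Import Order.TTheory GRing.Theory Num.Theory.
Import numFieldNormedType.Exports.

Set Implicit Arguments.
Unset Strict Implicit.
Unset Printing Implicit Defensive.

Local Open Scope classical_set_scope.
Local Open Scope ring_scope.

(** Take [psi_n x = f ((n + 1) x)] with
    [f x = cos (a - b) + cos (b - c) + cos (c - a)], where [a], [b], [c] are
    [2 pi] times the first three coordinates. The dilation preserves the measure
    of the torus, so for finite [p] the ratio does not depend on [n].
    Write [f = X + y] with [y = cos (c - a)] and
    [X = cos (a - b) + cos (b - c)]. Translating [b] by [pi] changes the sign of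
    [X] only; translating [(a, c)] by [(pi / 2, - pi / 2)] turns [(X, y)] into
    [(X', - y)] up to the sign of [X'], where
    [X' = sin (a - b) + sin (b - c)]. Let [h] be the odd function
    [sgn(x) |x|^p], [p > 1]. The sum of [h o f] over the four translates is
    [H y X - H y X'] with [H y X = h (y + X) + h (y - X)]. By convexity [H y X]
    is nondecreasing in [|X|] when [y >= 0] and nonincreasing when [y <= 0], and
    [X^2 - X'^2 = 2 y (1 + cos (a - 2 b + c))], so the sum is nonnegative. It is
    positive near the origin; hence the integral of [h o f] is positive, that
    is, the two norms differ. For [p = oo] use [- 3 / 2 <= f] and
    [f 0 = 3]. *)

(** * Inequalities for powers *)

Section powR_ineq.
Context {R : realType}.
Implicit Types (p x y a b : R).

(** Factor [x ^ p] as [x * x ^ (p - 1)]: the second factor is nondecreasing because [p >= 1]. *)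
Lemma powR_superadd p x y : 1 <= p -> 0 <= x -> 0 <= y ->
  x `^ p + y `^ p <= (x + y) `^ p.
Proof.
move=> p1 x0 y0; have p0 : 0 < p by rewrite (lt_le_trans _ p1).
have xy0 : 0 <= x + y by rewrite addr_ge0.
rewrite -(mulr_powRB1 x0 p0) -(mulr_powRB1 y0 p0) -(mulr_powRB1 xy0 p0) mulrDl.
by rewrite lerD// ler_wpM2l// ge0_ler_powR// ?nnegrE// ?subr_ge0//
  ?lerDl ?lerDr.
Qed.

Lemma powR_superadd_lt p x y : 1 < p -> 0 < x -> 0 < y ->
  x `^ p + y `^ p < (x + y) `^ p.
Proof.
move=> p1 x0 y0; have p0 : 0 < p by rewrite (lt_trans _ p1).
have xy0 : 0 < x + y by rewrite addr_gt0.
rewrite -(mulr_powRB1 (ltW x0) p0) -(mulr_powRB1 (ltW y0) p0).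
rewrite -(mulr_powRB1 (ltW xy0) p0) mulrDl.
by rewrite ltrD// ltr_pM2l// gt0_ltr_powR// ?nnegrE// ?subr_gt0//
  ?ltrDl ?ltrDr// ltW.
Qed.

(* Karamata's inequality for two points and the convex function [x `^ p]. *)
Lemma powR_add_spread p x y m : 1 <= p -> 0 <= x -> x <= m <= y ->
  m `^ p + (x + y - m) `^ p <= x `^ p + y `^ p.
Proof.
move=> p1 x0 /andP[xm my].
have [xy|] := ltP x y; last first.
  move=> yx; have -> : m = x by lra.
  by have -> : x + y - x = y by lra.
have y0 : 0 <= y by lra.
(* Weights expressing [m] and [x + y - m] as convex combinations of [x] and [y]; they sum to [1], so
   adding the two convexity inequalities gives the claim. *)
have t01 : 0 <= (y - m) / (y - x) <= 1.
  by rewrite divr_ge0 ?ler_pdivrMr ?mul1r//; lra.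
have s01 : 0 <= (m - x) / (y - x) <= 1.
  by rewrite divr_ge0 ?ler_pdivrMr ?mul1r//; lra.
have yx0 : y - x != 0 by rewrite subr_eq0 gt_eqF.
have cvx t (h : 0 <= t <= 1) :
    (t * x + (1 - t) * y) `^ p <= t * x `^ p + (1 - t) * y `^ p.
  have := @convex_powR R p p1 (Itv01 (andP h).1 (andP h).2) x y.
  rewrite !inE /= !in_itv/= !andbT => /(_ x0 y0) le_conv.
  by rewrite [X in X `^ _ <= _]convRE convRE in le_conv.
move: (cvx _ t01) (cvx _ s01).
have -> : (m - x) / (y - x) * x + (1 - (m - x) / (y - x)) * y = x + y - m.
  by field.
have -> : (y - m) / (y - x) * x + (1 - (y - m) / (y - x)) * y = m.
  by field.
have -> : (m - x) / (y - x) = 1 - (y - m) / (y - x) by field.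
set t := (y - m) / (y - x) => B A.
have -> : x `^ p + y `^ p = t * x `^ p + (1 - t) * y `^ p +
  ((1 - t) * x `^ p + (1 - (1 - t)) * y `^ p) by ring.
by rewrite lerD.
Qed.

Definition pos_powR p x := Num.max x 0 `^ p.

Lemma pos_powR_ge0 p x : 0 <= pos_powR p x.
Proof. exact: powR_ge0. Qed.

Lemma ge0_pos_powR p x : 0 <= x -> pos_powR p x = x `^ p.
Proof. by move=> x0; rewrite /pos_powR max_l. Qed.

Lemma le0_pos_powR p x : 0 < p -> x <= 0 -> pos_powR p x = 0.
Proof. by move=> p0 x0; rewrite /pos_powR max_r// powR0// gt_eqF. Qed.

(** For [p > 0] this is the function [h] of the outline, kept as a difference of nonnegative
    functions whose integrals are handled separately. *)
Definition odd_powR p x := pos_powR p x - pos_powR p (- x).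

Lemma odd_powRN p x : odd_powR p (- x) = - odd_powR p x.
Proof. by rewrite /odd_powR opprK opprB. Qed.

(** This is [H y a] of the outline. *)
Definition odd_powR_sum p y a := odd_powR p (y + a) + odd_powR p (y - a).

Lemma odd_powR_sumN p y a : odd_powR_sum p (- y) a = - odd_powR_sum p y a.
Proof.
rewrite /odd_powR_sum opprD -!odd_powRN addrC.
by congr (odd_powR _ _ + odd_powR _ _); ring.
Qed.

Lemma odd_powR_sum_norm p y a : odd_powR_sum p y `|a| = odd_powR_sum p y a.
Proof.
by case: (ger0P a) => // _; rewrite /odd_powR_sum opprK addrC.
Qed.

Lemma odd_powR_sum_ge p y a : 0 < p -> 0 <= a -> a <= y ->
  odd_powR_sum p y a = (y + a) `^ p + (y - a) `^ p.
Proof.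
move=> p0 a0 ay; rewrite /odd_powR_sum /odd_powR.
rewrite (@ge0_pos_powR _ (y + a)) ?(@ge0_pos_powR _ (y - a)); try lra.
by rewrite !le0_pos_powR ?subr0//; lra.
Qed.

Lemma odd_powR_sum_le p y a : 0 < p -> 0 <= y -> y <= a ->
  odd_powR_sum p y a = (y + a) `^ p - (a - y) `^ p.
Proof.
move=> p0 a0 ay; rewrite /odd_powR_sum /odd_powR opprB.
rewrite (@ge0_pos_powR _ (y + a)) ?(@ge0_pos_powR _ (a - y)); try lra.
by rewrite !le0_pos_powR ?subr0 ?sub0r//; lra.
Qed.

(** One may take [0 <= b <= a]. If [a <= y], the pair [y - a], [y + a] spreads [y - b], [y + b]. If
    [y <= b], the pair [b - y], [y + a] spreads [a - y], [y + b]. If [b < y < a], superadditivity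
    places [(2 y) ^ p] between the two sides. *)
Lemma odd_powR_sum_homo p y a b : 1 <= p -> 0 <= y -> `|b| <= `|a| ->
  odd_powR_sum p y b <= odd_powR_sum p y a.
Proof.
move=> p1 y0; rewrite -(odd_powR_sum_norm _ _ a) -(odd_powR_sum_norm _ _ b).
move: `|a| `|b| (normr_ge0 a) (normr_ge0 b) => {}a {}b a0 b0 ba.
have p0 : 0 < p by rewrite (lt_le_trans _ p1).
have [ay|ya] := leP a y.
  rewrite !odd_powR_sum_ge//; try lra.
  have := @powR_add_spread p (y - a) (y + a) (y + b) p1.
  have -> : y - a + (y + a) - (y + b) = y - b by ring.
  by lra.
rewrite (@odd_powR_sum_le _ _ a)//; try lra.
have [yb|yb] := leP y b.
  rewrite odd_powR_sum_le//.
  have := @powR_add_spread p (a - y) (y + a) (a + b) p1.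
  have := @powR_add_spread p (b - y) (y + a) (a - y) p1.
  have -> : b - y + (y + a) - (a - y) = y + b by ring.
  lra.
rewrite odd_powR_sum_ge//; try lra.
have := @powR_superadd p (y + b) (y - b) p1.
have := @powR_superadd p (y + y) (a - y) p1.
have -> : y + b + (y - b) = y + y by ring.
have -> : y + y + (a - y) = y + a by ring.
lra.
Qed.

(** Here [(2 y) ^ p] separates the two sides, strictly on the side of [a]. This is the regime met
    near the origin. *)
Lemma odd_powR_sum_lt p y a b : 1 < p -> `|b| < y -> y < `|a| ->
  odd_powR_sum p y b < odd_powR_sum p y a.
Proof.
move=> p1; rewrite -(odd_powR_sum_norm _ _ a) -(odd_powR_sum_norm _ _ b).
move: `|a| `|b| (normr_ge0 a) (normr_ge0 b) => {}a {}b a0 b0 bY ya.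
have p0 : 0 < p by rewrite (lt_trans _ p1).
rewrite (@odd_powR_sum_le _ _ a) ?(@odd_powR_sum_ge _ _ b); try lra.
have := @powR_superadd p (y + b) (y - b) (ltW p1).
have := @powR_superadd_lt p (y + y) (a - y) p1.
have -> : y + b + (y - b) = y + y by ring.
have -> : y + y + (a - y) = y + a by ring.
lra.
Qed.

End powR_ineq.

(** * The sum of three cosines *)

Section three_cosines.
Context {R : realType}.
Implicit Types (p a b c u v : R).

Definition cos3 a b c := cos (a - b) + cos (b - c) + cos (c - a).

(* [cos3 a b c] is [(|e^(ia) + e^(ib) + e^(ic)|^2 - 3) / 2]. *)
Lemma cos3_ge a b c : - (3 / 2) <= cos3 a b c.
Proof.
rewrite /cos3 !cosB.
have := sqr_ge0 (cos a + cos b + cos c).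
have := sqr_ge0 (sin a + sin b + sin c).
have := cos2Dsin2 a; have := cos2Dsin2 b; have := cos2Dsin2 c.
nra.
Qed.

(** Both sides are the real part of [(e^(iu) + e^(iv))^2 = 2 e^(i(u+v)) (1 + cos (u - v))]. With
    [u = a - b] and [v = b - c] it compares [|X|] with [|X'|] according to the sign of [y]. *)
Lemma cos_add_sqrB u v :
  (cos u + cos v) ^+ 2 - (sin u + sin v) ^+ 2 =
  2 * cos (u + v) * (1 + cos (u - v)).
Proof.
rewrite cosD cosB; have := sin2cos2 u; have := sin2cos2 v.
move: (sin u) (sin v) (cos u) (cos v) => su sv cu cv hv hu.
rewrite !sqrrD hu hv.
transitivity (2 * cu * cv - 2 * su * sv +
  2 * (cu ^+ 2 * cv ^+ 2 - su ^+ 2 * sv ^+ 2)); last by ring.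
by rewrite hu hv; ring.
Qed.

Definition cos3_shift_sum p a b c :=
  odd_powR p (cos3 a b c) + odd_powR p (cos3 a (b + pi) c) +
  (odd_powR p (cos3 (a + pi / 2) b (c - pi / 2)) +
   odd_powR p (cos3 (a + pi / 2) (b + pi) (c - pi / 2))).

(** The three nontrivial translates send [(X, y)] to [(- X, y)], [(- X', - y)] and [(X', - y)];
    oddness in [y] turns the last two terms into the subtracted one. *)
Lemma cos3_shift_sumE p a b c : cos3_shift_sum p a b c =
  odd_powR_sum p (cos (c - a)) (cos (a - b) + cos (b - c)) -
  odd_powR_sum p (cos (c - a)) (sin (a - b) + sin (b - c)).
Proof.
have cosBpi x : cos (x - pi) = - cos x.
  by rewrite -[in RHS](subrK pi x) cosDpi opprK.
have cosDpi' x : cos (x + pi) = - cos x by rewrite cosDpi.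
rewrite /cos3_shift_sum -odd_powR_sumN /odd_powR_sum /cos3.
have -> : a - (b + pi) = a - b - pi by ring.
have -> : b + pi - c = b - c + pi by ring.
have -> : a + pi / 2 - b = a - b + pi / 2 by ring.
have -> : b - (c - pi / 2) = b - c + pi / 2 by ring.
have -> : c - pi / 2 - (a + pi / 2) = c - a - pi by field.
have -> : a + pi / 2 - (b + pi) = a - b + pi / 2 - pi by ring.
have -> : b + pi - (c - pi / 2) = b - c + pi / 2 + pi by ring.
rewrite ?(cosBpi, cosDpi', cosDpihalf) [X in _ + _ + X]addrC.
by congr (odd_powR _ _ + odd_powR _ _ + (odd_powR _ _ + odd_powR _ _)); ring.
Qed.

Lemma cos3_shift_sum_ge0 p a b c : 1 <= p -> 0 <= cos3_shift_sum p a b c.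
Proof.
move=> p1; rewrite cos3_shift_sumE subr_ge0.
have := cos_add_sqrB (a - b) (b - c).
rewrite -[cos (a - b + _)]cosN; have -> : - (a - b + (b - c)) = c - a by ring.
have := cos_geN1 (a - b - (b - c)).
move: (cos (a - b - _)) (cos (c - a)) => z y z1.
set X := cos _ + cos _; set X' := sin _ + sin _ => XX'.
have [y0|y0] := leP 0 y.
  rewrite odd_powR_sum_homo// -ler_sqr ?nnegrE// !real_normK ?num_real//.
  nra.
(* For [y < 0] one has [|X| <= |X'|], and oddness reduces to the monotonicity at [- y]. *)
rewrite -lerN2 -!odd_powR_sumN odd_powR_sum_homo//; first lra.
by rewrite -ler_sqr ?nnegrE// !real_normK ?num_real//; nra.
Qed.

Lemma cosD_gt u v : 9 / 10 < cos u -> 9 / 10 < cos v ->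
  `|sin u| < 1 / 10 -> `|sin v| < 1 / 10 -> 4 / 5 < cos (u + v).
Proof.
move=> cu cv su sv; rewrite cosD.
have : 81 / 100 < cos u * cos v by nra.
have : sin u * sin v < 1 / 100.
  rewrite (le_lt_trans (ler_norm _))// normrM.
  by have := normr_ge0 (sin u); have := normr_ge0 (sin v); nra.
lra.
Qed.

(** The three cosines exceed [9 / 10], [9 / 10] and [4 / 5]. The bound [2] suffices, as it beats the
    bound [3 / 2] on the negative part. *)
Lemma cos3_gt2 a b c : 9 / 10 < cos (a - b) -> 9 / 10 < cos (b - c) ->
  `|sin (a - b)| < 1 / 10 -> `|sin (b - c)| < 1 / 10 -> 2 < cos3 a b c.
Proof.
move=> cu cv su sv; have := cosD_gt cu cv su sv.
rewrite /cos3 -[cos (c - a)]cosN.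
have -> : - (c - a) = a - b + (b - c) by ring.
lra.
Qed.

(** Here [|X'| < 1 / 5 < 4 / 5 < y <= 1 < 9 / 5 < X], so the strict comparison applies. *)
Lemma cos3_shift_sum_gt0 p a b c : 1 < p ->
  9 / 10 < cos (a - b) -> 9 / 10 < cos (b - c) ->
  `|sin (a - b)| < 1 / 10 -> `|sin (b - c)| < 1 / 10 ->
  0 < cos3_shift_sum p a b c.
Proof.
move=> p1 cu cv su sv; rewrite cos3_shift_sumE subr_gt0 odd_powR_sum_lt//.
- rewrite (le_lt_trans (ler_normD _ _))// -[cos (c - a)]cosN.
  have -> : - (c - a) = a - b + (b - c) by ring.
  by have := cosD_gt cu cv su sv; lra.
- by rewrite (le_lt_trans (cos_le1 _))// (lt_le_trans _ (ler_norm _))//; lra.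
Qed.

End three_cosines.

Lemma cos_sin_near0 {R : realType} : exists2 e : R, 0 < e &
  forall x, `|x| < e -> 9 / 10 < cos x /\ `|sin x| < 1 / 10.
Proof.
have cos_near : \forall x \near (0 : R), 9 / 10 < cos x.
  apply: (cvgr_gt _ (@continuous_cos R 0)); rewrite cos0; lra.
have sin_near : \forall x \near (0 : R), `|sin x| < 1 / 10.
  apply: (cvgr_norm_lt _ (@continuous_sin R 0)); rewrite sin0 normr0; lra.
have : \forall x \near (0 : R), 9 / 10 < cos x /\ `|sin x| < 1 / 10.
  exact: filterI cos_near sin_near.
move=> /nbhs_ballP[e /= e0 near_e].
by exists e => // x xe; apply: near_e; rewrite /ball/= sub0r normrN.
Qed.

(** * Trigonometric sums *)

(** Both derivatives are limits of the same difference quotient; this makes the one-variable rules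
    available for directional derivatives. *)
Lemma is_derive_line (R : numFieldType) (V W : normedModType R) (f : V -> W)
    (x v : V) (df : W) :
  is_derive (0 : R) 1 (fun h : R => f (h *: v + x)) df -> is_derive x v f df.
Proof.
move=> [dl <-]; split; first exact/(derivable1P f x v).2.
rewrite /derive; set g1 := fun h => _ *: (_ - f x); set g2 := fun h => _ *: _.
suff -> : g1 = g2 by []; apply/funext => h; rewrite /g1 /g2 /=.
by rewrite addr0 scale0r add0r [_%:A]mulr1.
Qed.

(** Writing [- sin] as a cosine with shifted phase keeps trigonometric sums closed under
    [partial]. *)
Lemma is_derive_cos_affine (R : realType) (a w c : R) :
  is_derive (0 : R) 1 (fun h => a * cos (w * h + c)) (a * w * cos (c + pi / 2)).
Proof.
have dl : is_derive (0 : R) 1 (fun h : R => w * h + c) w.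
  have := is_deriveD (is_deriveZ w (is_derive_id (0 : R) (1 : R)))
    (is_derive_cst c (0 : R) (1 : R)).
  by rewrite addr0 [_ *: _]mulr1.
have := is_deriveZ a (is_derive1_comp (is_derive_cos _) dl).
by rewrite mulr0 add0r cosDpihalf [_ *: _]mulrCA mulrC.
Qed.

Section trig_sum.
Context {R : realType} {d n : nat}.
Implicit Types (k : 'I_n -> 'I_d -> R) (a th : 'I_n -> R) (x : 'rV[R]_d).

Definition phase (w : 'I_d -> R) x := \sum_(i < d) w i * x ord0 i.

Lemma phaseD w x y : phase w (x + y) = phase w x + phase w y.
Proof. by rewrite -big_split; apply: eq_bigr => i _; rewrite mxE mulrDr. Qed.

Lemma phase_line w (h : R) i x : phase w (h *: 'e_i + x) = w i * h + phase w x.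
Proof.
rewrite phaseD; congr (_ + _); rewrite /phase (bigD1 i)//= !mxE !eqxx mulr1.
by rewrite big1 ?addr0// => j ji; rewrite !mxE (negbTE ji) andbF !mulr0.
Qed.

(** Amplitudes and phases are parameters because differentiation changes them while it fixes the
    frequencies; smoothness then follows by induction. *)
Definition trig_sum k a th x := \sum_(j < n) a j * cos (phase (k j) x + th j).

Lemma is_derive_trig_sum k a th i x : is_derive x 'e_i (trig_sum k a th)
  (trig_sum k (fun j => a j * k j i) (fun j => th j + pi / 2) x).
Proof.
apply: is_derive_line.
rewrite (_ : (fun h => _) = \sum_(j < n) (fun h : R =>
    a j * cos (k j i * h + (phase (k j) x + th j)))); last first.
  apply/funext => h; rewrite fct_sumE; apply: eq_bigr => j _.
  by rewrite phase_line addrA.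
apply: is_derive_sum => j.
have := is_derive_cos_affine (a j) (k j i) (phase (k j) x + th j).
by rewrite -[_ + th j + _]addrA.
Qed.

Lemma partial_trig_sum k a th i : partial i (trig_sum k a th) =
  trig_sum k (fun j => a j * k j i) (fun j => th j + pi / 2).
Proof.
by apply/funext => x; have [_ <-] := is_derive_trig_sum k a th i x.
Qed.

Lemma continuous_phase w : continuous (phase w).
Proof.
apply: continuous_big => [|i _ x]; first exact: add_continuous.
apply: (@continuousM R 'rV[R]_d (fun=> w i) (fun y => y ord0 i) x).
  exact: cst_continuous.
exact: coord_continuous.
Qed.

Lemma continuous_trig_sum k a th : continuous (trig_sum k a th).
Proof.
apply: continuous_big => [|j _ x]; first exact: add_continuous.
apply: (@continuousM R _ (fun=> a j) _ x); first exact: cst_continuous.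
apply: (@continuous_comp _ _ _ (fun x => phase (k j) x + th j)).
  apply: (@continuousD _ _ _ (phase (k j)) (fun=> th j)).
    exact: continuous_phase.
  exact: cst_continuous.
exact: continuous_cos.
Qed.

Lemma smooth_trig_sum k a th : smooth (trig_sum k a th).
Proof.
move=> s; rewrite /=; have [a' [th' ->]] : exists a' th',
    foldr partial (trig_sum k a th) s = trig_sum k a' th'.
  elim: s => [|i s [a' [th' IHs]]] /=; first by exists a, th.
  by rewrite IHs partial_trig_sum; eexists; eexists.
split; first exact: continuous_trig_sum.
by move=> i x; have [] := is_derive_trig_sum k a' th' i x.
Qed.

(** Two derivatives along [i] shift the phase by [pi] and so multiply the [j]-th term by
    [- k j i ^+ 2]. *)
Lemma laplacian_trig_sum k a th lambda x :
  (forall j, \sum_(i < d) k j i ^+ 2 = lambda) ->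
  - laplacian (trig_sum k a th) x = lambda * trig_sum k a th x.
Proof.
move=> kE; rewrite /laplacian.
under eq_bigr do rewrite !partial_trig_sum.
rewrite exchange_big -sumrN mulr_sumr; apply: eq_bigr => j _ /=.
rewrite -(kE j) mulr_suml -sumrN; apply: eq_bigr => i _.
rewrite !addrA cosDpihalf sinDpihalf; ring.
Qed.

Lemma cosD2piz (z : R) (m : int) : cos (z + pi *+ 2 * m%:~R) = cos z.
Proof.
have nat_case (y : R) (p : nat) : cos (y + pi *+ 2 * p%:R) = cos y.
  by rewrite mulr_natr periodicn//; exact: cosD2pi.
case: m => p; first exact: nat_case.
by rewrite NegzE mulrNz mulrN -[LHS](nat_case _ p.+1) subrK.
Qed.

Lemma lattice_periodic_trig_sum (m : 'I_n -> 'I_d -> int) a th :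
  lattice_periodic (trig_sum (fun j i => pi *+ 2 * (m j i)%:~R) a th).
Proof.
move=> l x; apply: eq_bigr => j _; congr (_ * _).
rewrite phaseD addrAC -[RHS](cosD2piz _ (\sum_(i < d) m j i * l ord0 i)).
congr (cos (_ + _)); rewrite rmorph_sum mulr_sumr; apply: eq_bigr => i _.
by rewrite mxE rmorphM mulrA.
Qed.

End trig_sum.

(** * The eigenfunctions *)

Section psi.
Context {R : realType} {d : nat} (i0 i1 i2 : 'I_d).
Hypotheses (i01 : i0 != i1) (i12 : i1 != i2) (i20 : i2 != i0).

Definition psi (n : nat) (x : 'rV[R]_d) : R :=
  let a i := pi *+ 2 * (n.+1%:R * x ord0 i) in cos3 (a i0) (a i1) (a i2).

Let freq n (j : 'I_3) (i : 'I_d) : int :=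
  n.+1%:Z * ((i == tnth [tuple i0; i1; i2] j)%:R -
             (i == tnth [tuple i1; i2; i0] j)%:R).

Lemma psi_trig_sum n : psi n =
  trig_sum (fun j i => pi *+ 2 * (freq n j i)%:~R) (fun=> 1) (fun=> 0).
Proof.
have sum_indic (p : 'I_d) (x : 'rV[R]_d) :
    \sum_(i < d) (i == p)%:R * x ord0 i = x ord0 p.
  rewrite (bigD1 p)//= eqxx mul1r big1 ?addr0// => i /negbTE ->.
  by rewrite mul0r.
have phaseE (p q : 'I_d) (x : 'rV[R]_d) :
    phase (fun i => pi *+ 2 * (n.+1%:Z * ((i == p)%:R - (i == q)%:R))%:~R) x =
    pi *+ 2 * (n.+1%:R * x ord0 p) - pi *+ 2 * (n.+1%:R * x ord0 q).
  rewrite -mulrBr -mulrBr -(sum_indic p x) -(sum_indic q x) -sumrB !mulr_sumr.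
  apply: eq_bigr => i _; rewrite rmorphM rmorphB /= !rmorph_nat; ring.
apply/funext => x; rewrite /trig_sum !big_ord_recl big_ord0 /freq !phaseE.
by rewrite /psi /cos3 !mul1r !addr0 addrA.
Qed.

(** Each frequency vector has exactly two nonzero entries, plus and minus [2 pi (n + 1)], since the
    coordinates are distinct; hence the common squared length. *)
Lemma psi_eigenfunction n :
  torus_eigenfunction (2 * (pi *+ 2 * n.+1%:R) ^+ 2) (psi n).
Proof.
split.
- rewrite psi_trig_sum; exact: lattice_periodic_trig_sum.
- rewrite psi_trig_sum; exact: smooth_trig_sum.
- exists 0; rewrite /psi /cos3 !mxE !mulr0 !subr0 cos0; apply: lt0r_neq0; lra.
- move=> x; rewrite psi_trig_sum; apply: laplacian_trig_sum.
  have sum_sqr (p q : 'I_d) : p != q -> \sum_(i < d)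
      (pi *+ 2 * (n.+1%:Z * ((i == p)%:R - (i == q)%:R))%:~R) ^+ 2 =
      2 * (pi *+ 2 * n.+1%:R) ^+ 2 :> R.
    move=> pq; rewrite (bigD1 p)//= (bigD1 q) 1?eq_sym//= !eqxx.
    rewrite [q == p]eq_sym (negbTE pq) big1 ?addr0.
      rewrite /= mulr0n mulr1n sub0r mulr1 mulrN1 mulrNz; ring.
    by move=> i /andP[/negbTE -> /negbTE ->]; rewrite subrr mulr0 mulr0 expr0n.
  by case=> -[|[|[|//]]] ?; exact: sum_sqr.
Qed.

End psi.

(** * Integrals of periodic functions over the unit cube *)

Lemma mule_posI {R : realDomainType} (k : R) (x y : \bar R) : 0 < k ->
  (k%:E * x = k%:E * y)%E -> x = y.
Proof.
move=> k0 kxy; apply/eqP.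
by rewrite eq_le -(@lee_pmul2l _ k%:E)// kxy lexx -(@lee_pmul2l _ k%:E)// kxy/=.
Qed.

Section affine_change_of_variable.
Context {R : realType}.
Implicit Types (a c s t : R) (g : R -> \bar R).
Local Open Scope ereal_scope.
Local Notation mu := (@lebesgue_measure R).

Lemma measurable_affine a c :
  measurable_fun [set: measurableTypeR R]
    (fun x => (a * x + c)%R : measurableTypeR R).
Proof. by apply: measurable_funD => //; exact: measurable_funM. Qed.

(** The sides are arbitrary: []s, t]] serves to characterise Lebesgue measure, [[s, t[] to integrate
    over periods. *)
Lemma affine_preimage_itv a c s t b1 b2 : (0 < a)%R ->
  (fun x => a * x + c)%R @^-1`
    [set` Interval (BSide b1 (a * s + c)%R) (BSide b2 (a * t + c)%R)] =
  [set` Interval (BSide b1 s) (BSide b2 t)].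
Proof.
move=> a0; apply/seteqP; split=> x /=; rewrite !in_itv/=;
  by case: b1; case: b2 => /=; rewrite ?lerD2r ?ltrD2r ?ler_pM2l ?ltr_pM2l.
Qed.

(** The image measure under [x |-> a x + c], scaled by [a], agrees with Lebesgue measure on the
    intervals []s, t]], hence everywhere. *)
Lemma ge0_integral_affine a c g : (0 < a)%R ->
  measurable_fun [set: measurableTypeR R] g -> (forall x, 0 <= g x) ->
  a%:E * \int[mu]_x g (a * x + c)%R = \int[mu]_x g x.
Proof.
move=> a0 mg g0; pose f x : measurableTypeR R := (a * x + c)%R.
have mf := measurable_affine a c.
pose nu := mscale (NngNum (ltW a0)) (pushforward mu f).
rewrite [RHS](eq_measure_integral (nu mf)); last first.
  move=> A mA _.
  apply: (@lebesgue_measure_unique _ (nu mf)) => // _ [[s t] _ <-].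
  rewrite -[RHS]/(a%:E * mu (f @^-1` `]s, t])) /f.
  have rescale z : z = (a * ((z - c) / a) + c)%R by field; rewrite gt_eqF.
  rewrite [in RHS](rescale s) [in RHS](rescale t) affine_preimage_itv//.
  rewrite !lebesgue_measure_itv/= !lte_fin ltr_pM2r ?invr_gt0// ltrD2r.
  case: ifPn => _; last by rewrite mule0.
  by rewrite -EFinM; congr EFin; field; rewrite gt_eqF.
by rewrite ge0_integral_mscale//= ge0_integral_pushforward.
Qed.

Lemma ge0_integral_affine_itv a c s t g : (0 < a)%R ->
  measurable_fun [set: measurableTypeR R] g -> (forall x, 0 <= g x) ->
  a%:E * \int[mu]_(x in `[s, t[) g (a * x + c)%R =
  \int[mu]_(x in `[(a * s + c)%R, (a * t + c)%R[) g x.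
Proof.
move=> a0 mg g0; rewrite integral_mkcond [RHS]integral_mkcond.
rewrite -(@ge0_integral_affine a c (g \_ _))//; last 2 first.
- by apply/(measurable_restrictT _ _).1 => //; exact: measurable_funTS.
- by move=> x; rewrite patchE; case: ifPn.
congr (_ * _); apply: eq_integral => x _; rewrite !patchE.
by rewrite -(@affine_preimage_itv a c s t)// !in_setE.
Qed.

End affine_change_of_variable.

Section periodic_integral.
Context {R : realType}.
Local Open Scope ereal_scope.
Local Notation mu := (@lebesgue_measure R).
Variable g : R -> \bar R.
Hypotheses (mg : measurable_fun [set: measurableTypeR R] g)
  (g0 : forall x, 0 <= g x)
  (g_periodic : forall (m : int) x, g (x + m%:~R)%R = g x).

Let measurable_g D : measurable_fun (D : set (measurableTypeR R)) g.
Proof. exact: measurable_funTS. Qed.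

Let integral_cat a b c : (a <= b)%R -> (b <= c)%R ->
  \int[mu]_(x in `[a, c[) g x =
  \int[mu]_(x in `[a, b[) g x + \int[mu]_(x in `[b, c[) g x.
Proof.
move=> ab bc; rewrite -ge0_integral_setU//; last first.
  apply/disj_setPS => x [] /=; rewrite !in_itv/= => /andP[_ xb] /andP[].
  by rewrite leNgt xb.
congr (integral _ _ _); apply/seteqP; split=> x /=; rewrite !in_itv/=.
  by move=> /andP[ax xc]; case: (ltP x b) => ?; [left; rewrite ax|right].
move=> [] /andP[h1 h2]; first by rewrite h1 (lt_le_trans h2).
by rewrite h2 (le_trans ab).
Qed.

Let integral_shift (m : int) a b :
  \int[mu]_(x in `[(a + m%:~R)%R, (b + m%:~R)%R[) g x =
  \int[mu]_(x in `[a, b[) g x.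
Proof.
have := @ge0_integral_affine_itv R 1 m%:~R a b g ltr01 mg g0.
rewrite mul1e !mul1r => <-; apply: eq_integral => x _.
by rewrite mul1r g_periodic.
Qed.

(** Modulo an integer shift, [c] is some [r] in [[0, 1]]; cut [[r, r + 1[] at [1] and move the right
    piece to [[0, r[]. *)
Lemma integral_period c :
  \int[mu]_(x in `[c, (c + 1)%R[) g x = \int[mu]_(x in `[0%R, 1%R[) g x.
Proof.
have [r [m [r0 r1 ->]]] : exists r (m : int),
    [/\ (0 <= r)%R, (r <= 1)%R & c = (r + m%:~R)%R].
  exists (c - (Num.floor c)%:~R)%R, (Num.floor c); split.
  - by rewrite subr_ge0 floor_le.
  - by rewrite lerBlDl ltW// -[X in (_ + X)%R]/(1%:~R) -intrD floorD1_gt.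
  - by rewrite subrK.
rewrite addrAC integral_shift (@integral_cat _ 1%R)//; last by rewrite lerDr.
rewrite [RHS](@integral_cat _ r)// addeC; congr (_ + _).
by rewrite -(integral_shift 1 0 r) add0r.
Qed.

Lemma integral_periods c n :
  \int[mu]_(x in `[c, (c + n%:R)%R[) g x =
  n%:R%:E * \int[mu]_(x in `[0%R, 1%R[) g x.
Proof.
elim: n => [|n IHn]; first by rewrite addr0 mul0e set_itvco0 integral_set0.
rewrite -natr1 addrA (@integral_cat _ (c + n%:R)%R) ?lerDl// IHn.
by rewrite integral_period EFinD ge0_muleDl ?lee_fin// mul1e.
Qed.

(** The affine map covers [n + 1] periods, and this factor cancels the Jacobian. *)
Lemma integral_periodic_affine n c :
  \int[mu]_(x in `[0%R, 1%R[) g (n.+1%:R * x + c)%R =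
  \int[mu]_(x in `[0%R, 1%R[) g x.
Proof.
have := @ge0_integral_affine_itv R n.+1%:R c 0 1 g (ltr0Sn _ _) mg g0.
rewrite mulr0 add0r mulr1 [(_ + c)%R]addrC integral_periods.
exact/mule_posI/ltr0Sn.
Qed.

Lemma integral_unit_intervalE :
  \int[unit_interval_measure]_x g x = \int[mu]_(x in `[0%R, 1%R[) g x.
Proof.
have m01 : measurable (`[0%R, 1%R[%classic : set (measurableTypeR R)).
  exact: measurable_itv.
rewrite (ge0_negligible_integral (measurableC m01))//; last first.
  by rewrite -[LHS]/(mu (~` `[0%R, 1%R[ `&` `[0%R, 1%R[)) setICl measure0.
rewrite setTD setCK; apply: eq_measure_integral => A mA A01.
by rewrite -[LHS]/(mu (A `&` `[0%R, 1%R[)) setIidl.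
Qed.

End periodic_integral.

Lemma integral_unit_interval_affine {R : realType} (g : R -> \bar R) n (c : R) :
  measurable_fun [set: measurableTypeR R] g -> (forall x, (0 <= g x)%E) ->
  (forall (m : int) x, g (x + m%:~R) = g x) ->
  (\int[unit_interval_measure]_x g (n.+1%:R * x + c)%R =
   \int[unit_interval_measure]_x g x)%E.
Proof.
move=> mg g0 gper; rewrite !integral_unit_intervalE ?integral_periodic_affine//.
by apply: measurableT_comp mg _; exact: measurable_affine.
Qed.

Section cube_integral.
Context {R : realType}.
Local Open Scope ereal_scope.

Lemma mktuple_cons d (T T' : Type) (F : 'I_d.+1 -> T -> T') x (t : d.-tuple T) :
  [tuple F i (tnth [tuple of x :: t] i) | i < d.+1] =
  [tuple of F ord0 x :: [tuple F (lift ord0 i) (tnth t i) | i < d]].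
Proof.
apply: eq_from_tnth => i; rewrite tnth_mktuple.
have [j ->|->] := unliftP ord0 i; last by rewrite !tnth0.
by rewrite !tnthS tnth_mktuple.
Qed.

Lemma measurable_affine_tuple d (a : R) (c : 'I_d -> R) :
  measurable_fun [set: d.-tuple (measurableTypeR R)]
    (fun t => [tuple (a * tnth t i + c i)%R : measurableTypeR R | i < d]).
Proof.
apply/measurable_fun_tnthP => i /=.
rewrite (_ : _ \o _ = fun t => (a * tnth t i + c i)%R); last first.
  by apply/funext => t /=; rewrite tnth_mktuple.
apply: measurableT_comp (measurable_affine a (c i)) _.
exact: measurable_tnth.
Qed.

(** Induction on the dimension: by Tonelli the coordinates are treated one at a time, each by the
    one-dimensional case. *)
Lemma integral_unit_cube_affine n d (c : 'I_d -> R)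
    (g : d.-tuple (measurableTypeR R) -> \bar R) :
  measurable_fun setT g -> (forall t, 0 <= g t) ->
  (forall (m : 'I_d -> int) t,
    g [tuple (tnth t i + (m i)%:~R)%R | i < d] = g t) ->
  \int[unit_cube_measure d]_t g [tuple (n.+1%:R * tnth t i + c i)%R | i < d] =
  \int[unit_cube_measure d]_t g t.
Proof.
elim: d c g => [|d IHd] c g mg g0 gper.
  apply: eq_integral => t _; congr g.
  exact: etrans (tuple0 _) (esym (tuple0 _)).
have mG : measurable_fun setT (g \o @cons_pair R d).
  by apply: measurableT_comp mg _; exact: measurable_cons.
have gcons_per (k : int) (m : 'I_d -> int) x (t : d.-tuple R) :
    g [tuple of (x + k%:~R)%R :: [tuple (tnth t i + (m i)%:~R)%R | i < d]] =
    g [tuple of x :: t].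
  rewrite -[RHS](gper (fun i => if unlift ord0 i is Some j then m j else k)).
  rewrite (mktuple_cons (fun i z => z + _)%R) unlift_none; congr g.
  by congr [tuple of _ :: _]; apply: eq_mktuple => i; rewrite liftK.
have add0 (t : d.-tuple R) : [tuple (tnth t i + 0%R%:~R)%R | i < d] = t.
  by apply: eq_from_tnth => i; rewrite tnth_mktuple addr0.
have maff : measurable_fun setT (fun t : d.+1.-tuple (measurableTypeR R) =>
    g [tuple (n.+1%:R * tnth t i + c i)%R | i < d.+1]).
  by apply: measurableT_comp mg _; exact: measurable_affine_tuple.
have maff1 : measurable_fun setT
    (fun z : measurableTypeR R * d.-tuple (measurableTypeR R) =>
      g [tuple of (n.+1%:R * z.1 + c ord0)%R :: z.2]).
  apply: measurableT_comp mg _; apply: measurable_cons => //.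
  exact: (measurableT_comp (measurable_affine _ _) measurable_fst).
rewrite /= !ge0_integral_distribution// !fubini_tonelli1//; last 3 first.
- by move=> z; exact: g0.
- by apply: measurableT_comp maff _; exact: measurable_cons.
- by move=> z; exact: g0.
rewrite /fubini_F.
(* The induction hypothesis removes the affine map from the last [d] coordinates; the order of
   integration is then exchanged to treat the first one. *)
transitivity (\int[unit_interval_measure]_x \int[unit_cube_measure d]_t
    g [tuple of (n.+1%:R * x + c ord0)%R :: t]).
  apply: eq_integral => x _.
  rewrite -[RHS](IHd (fun i => c (lift ord0 i)))//; last 2 first.
  - by apply: measurableT_comp mg _; exact: measurable_cons.
  - by move=> m t; rewrite -[in RHS](gcons_per 0%R m) addr0.
  apply: eq_integral => t _.
  by rewrite /= (mktuple_cons (fun i z => n.+1%:R * z + c i)%R).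
rewrite (fubini_tonelli _ maff1)//.
rewrite (fubini_tonelli _ mG); last by move=> z; exact: g0.
apply: eq_integral => t _.
apply: (@integral_unit_interval_affine _ (fun x => g [tuple of x :: t])) => //.
  by apply: measurableT_comp mg _; exact: measurable_cons.
by move=> m x; rewrite -[in RHS](gcons_per m (fun=> 0%R)) add0.
Qed.

End cube_integral.

Lemma measurable_cube_box {R : realType} n
    (A : 'I_n -> set (measurableTypeR R)) :
  (forall i, measurable (A i)) ->
  measurable [set t : n.-tuple (measurableTypeR R) | forall i, A i (tnth t i)].
Proof.
move=> mA.
rewrite (_ : [set _ | _] = \bigcap_(i in [set: 'I_n])
    ((@tnth n (measurableTypeR R) ^~ i) @^-1` A i)).
  apply: fin_bigcap_measurable => // i _; rewrite -[_ @^-1` _]setTI.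
  exact: measurable_tnth.
by apply/seteqP; split => t /= tA i; [move=> _; exact: tA | exact: tA].
Qed.

(** The part of a neighbourhood of the origin that lies in the fundamental domain; there the
    coordinates differ by less than [e]. *)
Definition corner_box {R : realType} (n : nat) (e : R) :
    set (n.-tuple (measurableTypeR R)) :=
  [set t | forall i, tnth t i \in `[0, e[].
Arguments corner_box {R} n e _.

Lemma measurable_corner_box {R : realType} (n : nat) (e : R) :
  measurable (corner_box n e).
Proof.
apply: (@measurable_cube_box R n (fun=> `[0, e[%classic)) => i.
exact: measurable_itv.
Qed.

Lemma corner_box_gt0 {R : realType} n (e : R) : 0 < e ->
  (0 < unit_cube_measure n (corner_box n e))%E.
Proof.
move=> e0; rewrite (unit_cube_measure_box (A := fun=> `[0, e[%classic));
  last by move=> i; exact: measurable_itv.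
elim/big_ind: _ => // [x y x0 y0|i _]; first by rewrite mule_gt0.
(* The side [e] may exceed [1]. *)
rewrite (_ : _ `&` _ = `[0, Num.min e 1[%classic); last first.
  apply/seteqP; split=> x /=; rewrite !in_itv/= lt_min.
    by move=> [/andP[-> ->] /andP[_ ->]].
  by move=> /and3P[-> -> ->].
rewrite lebesgue_measure_itv/= lte_fin lt_min e0 ltr01 sube0 lte_fin lt_min.
by rewrite e0 ltr01.
Qed.

(** * Comparison of the positive and negative parts *)

Lemma measurable_pos_powR {R : realType} (p : R) :
  measurable_fun setT (pos_powR p).
Proof.
apply: (measurableT_comp (measurable_powR p)).
by apply: measurable_maxr.
Qed.

Section distribution.
Context {R : realType} {d : nat} (i0 i1 i2 : 'I_d).
Hypotheses (i01 : i0 != i1) (i12 : i1 != i2) (i20 : i2 != i0).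
Local Notation P := (@unit_cube_measure R d).
Local Notation T := (d.-tuple (measurableTypeR R)).

Definition angle (t : T) i : R := pi *+ 2 * tnth t i.

Definition cos3_tuple (t : T) := cos3 (angle t i0) (angle t i1) (angle t i2).

Lemma measurable_cos_diff i j :
  measurable_fun setT (fun t : T => cos (angle t i - angle t j)).
Proof.
apply: measurableT_comp.
  exact: continuous_measurable_fun (@continuous_cos R).
by apply: measurable_funB; apply: measurable_funM => //; exact: measurable_tnth.
Qed.

Lemma measurable_cos3_tuple : measurable_fun setT cos3_tuple.
Proof.
apply: measurable_funD; last exact: measurable_cos_diff.
by apply: measurable_funD; exact: measurable_cos_diff.
Qed.

Lemma cos3_tuple_periodic (m : 'I_d -> int) (t : T) :
  cos3_tuple [tuple (tnth t i + (m i)%:~R : measurableTypeR R) | i < d] =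
  cos3_tuple t.
Proof.
rewrite /cos3_tuple /cos3 /angle !tnth_mktuple.
have cosz i j : cos (pi *+ 2 * (tnth t i + (m i)%:~R) -
    pi *+ 2 * (tnth t j + (m j)%:~R)) =
    cos (pi *+ 2 * tnth t i - pi *+ 2 * tnth t j).
  rewrite -[RHS](cosD2piz _ (m i - m j)); congr cos.
  by rewrite rmorphB /=; ring.
by rewrite !cosz.
Qed.

(** This serves twice: with [c = 0] for the dilation in [psi], and with [n = 0] for the translates
    in [four_shifts]. *)
Lemma integral_cos3_affine n (c : 'I_d -> R) (h : R -> R) :
  measurable_fun setT h -> (forall x, 0 <= h x) ->
  (\int[P]_t (h (cos3_tuple
     [tuple (n.+1%:R * tnth t i + c i)%R : measurableTypeR R | i < d]))%:E =
   \int[P]_t (h (cos3_tuple t))%:E)%E.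
Proof.
move=> mh h0.
apply: (@integral_unit_cube_affine R n d c (fun t => (h (cos3_tuple t))%:E)).
- apply/measurable_EFinP; apply: measurableT_comp mh _.
  exact: measurable_cos3_tuple.
- by move=> t; rewrite lee_fin.
- by move=> m t; rewrite cos3_tuple_periodic.
Qed.

(* The factor [1%:R] makes this the case [n = 0] of [integral_cos3_affine]. *)
Definition shift (u v : R) (t : T) : T :=
  [tuple (1%:R * tnth t i + (if i == i0 then u else if i == i1 then v else
    if i == i2 then - u else 0))%R : measurableTypeR R | i < d].

Lemma cos3_tuple_shift u v t : cos3_tuple (shift u v t) =
  cos3 (angle t i0 + pi *+ 2 * u) (angle t i1 + pi *+ 2 * v)
       (angle t i2 - pi *+ 2 * u).
Proof.
rewrite /cos3_tuple /angle !tnth_mktuple !mul1r !eqxx.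
rewrite [i1 == i0]eq_sym (negbTE i01) (negbTE i20).
rewrite [i2 == i1]eq_sym (negbTE i12).
by rewrite !mulrDr mulrN.
Qed.

Lemma measurable_shift u v : measurable_fun setT (shift u v).
Proof. exact: measurable_affine_tuple. Qed.

(** Coordinate shifts by [1 / 2] and [1 / 4] are angle shifts by [pi] and [pi / 2]. *)
Definition four_shifts (h : R -> R) (t : T) :=
  h (cos3_tuple (shift 0 0 t)) + h (cos3_tuple (shift 0 2^-1 t)) +
  (h (cos3_tuple (shift 4^-1 0 t)) + h (cos3_tuple (shift 4^-1 2^-1 t))).

Lemma four_shifts_odd_powR p t : four_shifts (odd_powR p) t =
  cos3_shift_sum p (angle t i0) (angle t i1) (angle t i2).
Proof.
rewrite /four_shifts !cos3_tuple_shift !mulr0 !addr0 !subr0.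
have -> : pi *+ 2 / 2 = pi :> R by field.
by have -> : pi *+ 2 / 4 = pi / 2 :> R by field.
Qed.

Section four_shifts_integral.
Variable h : R -> R.
Hypotheses (mh : measurable_fun setT h) (h0 : forall x, 0 <= h x).

Let h_shift u v t := h (cos3_tuple (shift u v t)).

Let measurable_h_shift u v : measurable_fun setT (h_shift u v).
Proof.
apply: measurableT_comp mh _.
by apply: measurableT_comp (measurable_shift u v); exact: measurable_cos3_tuple.
Qed.

Lemma measurable_four_shifts : measurable_fun setT (four_shifts h).
Proof.
by apply: measurable_funD; apply: measurable_funD; exact: measurable_h_shift.
Qed.

Lemma integral_four_shifts :
  (\int[P]_t (four_shifts h t)%:E =
   4%:E * \int[P]_t (h (cos3_tuple t))%:E)%E.
Proof.
have int_shift u v :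
    (\int[P]_t (h_shift u v t)%:E = \int[P]_t (h (cos3_tuple t))%:E)%E.
  exact: integral_cos3_affine.
have mE u v : measurable_fun setT (fun t => (h_shift u v t)%:E).
  exact/measurable_EFinP.
have E0 u v t : (0 <= (h_shift u v t)%:E)%E by rewrite lee_fin; exact: h0.
have int2 u v u' v' : (\int[P]_t ((h_shift u v t)%:E + (h_shift u' v' t)%:E) =
    \int[P]_t (h (cos3_tuple t))%:E + \int[P]_t (h (cos3_tuple t))%:E)%E.
  by rewrite ge0_integralD//; congr (_ + _)%E; exact: int_shift.
rewrite /four_shifts; under eq_integral do rewrite !EFinD.
rewrite ge0_integralD//; last 4 first.
- by move=> t _; rewrite adde_ge0// E0.
- by apply: emeasurable_funD; exact: mE.
- by move=> t _; rewrite adde_ge0// E0.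
- by apply: emeasurable_funD; exact: mE.
rewrite !int2.
have -> : 4%:E = (1 + 1 + (1 + 1))%:E :> \bar R by congr EFin; ring.
by rewrite !EFinD !ge0_muleDl ?mul1e// ?lee_fin.
Qed.

End four_shifts_integral.

Lemma four_shifts_odd_powR_ge0 p t : 1 <= p -> 0 <= four_shifts (odd_powR p) t.
Proof. by move=> p1; rewrite four_shifts_odd_powR cos3_shift_sum_ge0. Qed.

Lemma four_shifts_odd_powRB p t : four_shifts (odd_powR p) t =
  four_shifts (pos_powR p) t - four_shifts (fun x => pos_powR p (- x)) t.
Proof.
have sumB (x y z w x' y' z' w' : R) :
  x - x' + (y - y') + ((z - z') + (w - w')) =
  x + y + (z + w) - (x' + y' + (z' + w')) by ring.
exact: sumB.
Qed.

Lemma measurable_neg_pos_powR p :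
  measurable_fun setT (fun x : R => pos_powR p (- x)).
Proof. by apply: measurableT_comp => //; exact: measurable_pos_powR. Qed.

Lemma measurable_four_shifts_odd_powR p :
  measurable_fun setT (four_shifts (odd_powR p)).
Proof.
rewrite (_ : four_shifts _ = four_shifts (pos_powR p) \-
    four_shifts (fun x => pos_powR p (- x))); last first.
  by apply/funext => t; exact: four_shifts_odd_powRB.
apply: measurable_funB; apply: measurable_four_shifts.
  exact: measurable_pos_powR.
exact: measurable_neg_pos_powR.
Qed.

(** A nonnegative function with zero integral vanishes almost everywhere, but this one is positive
    on a corner box of positive measure. *)
Lemma integral_four_shifts_odd_powR_gt0 p : 1 < p ->
  (0 < \int[P]_t (four_shifts (odd_powR p) t)%:E)%E.
Proof.
move=> p1; rewrite lt0e integral_ge0 ?andbT; last first.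
  by move=> t _; rewrite lee_fin four_shifts_odd_powR_ge0// ltW.
have [e e0 small] := @cos_sin_near0 R.
have pi2 : 0 < pi *+ 2 :> R by rewrite mulrn_wgt0// pi_gt0.
pose b := e / (pi *+ 2).
have b0 : 0 < b by exact: divr_gt0.
have D_gt0 t : corner_box d b t -> 0 < four_shifts (odd_powR p) t.
  move=> tb; rewrite four_shifts_odd_powR.
  have tij i j : `|angle t i - angle t j| < e.
    rewrite -mulrBr normrM (gtr0_norm pi2) mulrC -ltr_pdivlMr//.
    have := tb i; have := tb j; rewrite !in_itv/= => /andP[? ?] /andP[? ?].
    by rewrite ltr_norml; apply/andP; split; rewrite -/b; lra.
  have [? ?] := small _ (tij i0 i1); have [? ?] := small _ (tij i1 i2).
  exact: cos3_shift_sum_gt0.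
apply/eqP => int_D0.
have : ae_eq P setT (fun t => (four_shifts (odd_powR p) t)%:E) (cst 0%E).
  apply/ae_eq_integral_abs => //.
    by apply/measurable_EFinP; exact: measurable_four_shifts_odd_powR.
  rewrite -[RHS]int_D0; apply: eq_integral => t _.
  by rewrite gee0_abs// lee_fin four_shifts_odd_powR_ge0// ltW.
move=> [N [mN PN0 DN]].
have := corner_box_gt0 d b0; rewrite (subset_measure0 _ _ _ PN0) ?ltxx//.
  exact: measurable_corner_box.
move=> t tb; apply: DN => /= /(_ Logic.I) [] Dt0.
by have := D_gt0 _ tb; rewrite Dt0 ltxx.
Qed.

(** The integrand is at most [(3 / 2) ^ p] by [cos3_ge]. Finiteness makes adding a positive integral
    a strict increase. *)
Lemma integral_neg_pos_powR_fin p : 0 < p ->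
  (\int[P]_t (pos_powR p (- cos3_tuple t))%:E)%E \is a fin_num.
Proof.
move=> p0; rewrite ge0_fin_numE; last first.
  by apply: integral_ge0 => t _; rewrite lee_fin pos_powR_ge0.
apply: (@le_lt_trans _ _ (\int[P]_t ((3 / 2) `^ p)%:E)%E).
  apply: ge0_le_integral => //.
  - by move=> t _; rewrite lee_fin pos_powR_ge0.
  - apply/measurable_EFinP.
    apply: measurableT_comp (measurable_neg_pos_powR p) _.
    exact: measurable_cos3_tuple.
  - move=> t _; rewrite lee_fin ge0_ler_powR ?nnegrE ?le_max ?lexx ?orbT//.
    + exact: ltW.
    + rewrite ge_max; have := cos3_ge (angle t i0) (angle t i1) (angle t i2).
      by rewrite /cos3_tuple => ?; apply/andP; split; lra.
rewrite integral_cst//= (_ : P setT = 1%E) ?mule1 ?ltry//.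
exact: probability_setT.
Qed.

(** Summing over the four translates multiplies both integrals by [4] and makes the difference of
    the integrands nonnegative pointwise. *)
Lemma integral_pos_powR_gt p : 1 < p ->
  (\int[P]_t (pos_powR p (- cos3_tuple t))%:E <
   \int[P]_t (pos_powR p (cos3_tuple t))%:E)%E.
Proof.
move=> p1.
have neg0 x : 0 <= pos_powR p (- x) by exact: pos_powR_ge0.
have mneg := measurable_neg_pos_powR p.
have : (\int[P]_t (four_shifts (fun x => pos_powR p (- x)) t)%:E <
        \int[P]_t (four_shifts (pos_powR p) t)%:E)%E.
  have -> : (\int[P]_t (four_shifts (pos_powR p) t)%:E =
    \int[P]_t (four_shifts (fun x => pos_powR p (- x)) t)%:E +
    \int[P]_t (four_shifts (odd_powR p) t)%:E)%E.
    rewrite -ge0_integralD//.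
    - by apply: eq_integral => t _; rewrite -EFinD four_shifts_odd_powRB subrKC.
    - by move=> t _; rewrite lee_fin !addr_ge0.
    - by apply/measurable_EFinP; exact: measurable_four_shifts.
    - by move=> t _; rewrite lee_fin four_shifts_odd_powR_ge0// ltW.
    - by apply/measurable_EFinP; exact: measurable_four_shifts_odd_powR.
  rewrite lteDl ?integral_four_shifts_odd_powR_gt0// integral_four_shifts//.
  by rewrite fin_numM// integral_neg_pos_powR_fin// (lt_trans _ p1).
rewrite !integral_four_shifts ?lte_pmul2l//.
- exact: measurable_pos_powR.
- exact: pos_powR_ge0.
Qed.

End distribution.

(** * Norms of the positive and negative parts of the eigenfunctions *)

Lemma pos_partE {R : realType} {T : Type} (f : T -> R) x :
  pos_part f x = Num.max (f x) 0.
Proof.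
rewrite /pos_part indicE; case: (ltP 0 (f x)) => fx.
  by rewrite mem_set// mulr1.
by rewrite memNset ?mulr0//= ltNge fx.
Qed.

Lemma neg_partE {R : realType} {T : Type} (f : T -> R) x :
  neg_part f x = Num.max (- f x) 0.
Proof.
rewrite -[RHS](pos_partE (- f)) /neg_part /pos_part; congr (_ * _).
by rewrite !indicE; congr (_%:R); congr (nat_of_bool (_ \in _)); apply/seteqP;
  split => y /=; rewrite oppr_gt0.
Qed.

Lemma torus_Lnorm_fin {R : realType} {d : nat} (p : R) (f : 'rV[R]_d -> R) :
  torus_Lnorm p%:E f =
  ((\int[unit_cube_measure d]_t (`|f (\row_i tnth t i)| `^ p)%:E) `^ p^-1)%E.
Proof. by rewrite /torus_Lnorm unlock. Qed.

(* The junk values [0^-1 = +oo], [+oo^-1 = 0], [-oo^-1 = -oo] in [\bar R] never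
   make [x / y] equal to [1]. *)
Lemma ereal_div_eq1 {R : realType} (x y : \bar R) : (x / y = 1 -> x = y)%E.
Proof.
case: (inveP y) => [|||r r0].
- move=> h; have [x0|x0|x0] := ltgtP x 0%E.
  + by move: h; rewrite lt0_muley.
  + by move: h; rewrite gt0_muley.
  + by move: h; rewrite x0 mul0e => /eqP; rewrite eq_sym onee_eq0.
- by rewrite mule0 => /eqP; rewrite eq_sym onee_eq0.
- move=> h; have [x0|x0|x0] := ltgtP x 0%E.
  + by move: h; rewrite lt0_muleNy.
  + by move: h; rewrite gt0_muleNy.
  + by move: h; rewrite x0 mul0e => /eqP; rewrite eq_sym onee_eq0.
- by move=> h; rewrite -[x]mule1 -[1%E]/(1%:E) -(mulVf r0) EFinM muleA h mul1e.
Qed.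

Lemma poweRV_inj {R : realType} (p : R) (x y : \bar R) :
  0 < p -> (0 <= x)%E -> (0 <= y)%E ->
  (x `^ p^-1 = y `^ p^-1)%E -> x = y.
Proof.
move=> p0 x0 y0 /(congr1 (fun z => z `^ p)%E).
by rewrite -!poweRrM mulVf ?gt_eqF// !poweRe1.
Qed.

Section torus_norms.
Context {R : realType} {d : nat} (i0 i1 i2 : 'I_d).
Hypotheses (i01 : i0 != i1) (i12 : i1 != i2) (i20 : i2 != i0).
Local Notation P := (@unit_cube_measure R d).
Local Notation T := (d.-tuple (measurableTypeR R)).
Local Notation psi := (@psi R d i0 i1 i2).
Local Notation cos3_tuple := (@cos3_tuple R d i0 i1 i2).

(** The summand [0] is the null translation expected by [integral_cos3_affine]. *)
Lemma psi_tuple n (t : T) : psi n (\row_i tnth t i) =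
  cos3_tuple [tuple (n.+1%:R * tnth t i + 0)%R : measurableTypeR R | i < d].
Proof. by rewrite /psi /cos3_tuple /angle !mxE !tnth_mktuple !addr0. Qed.

Lemma torus_Lnorm_psi_pos p n :
  torus_Lnorm p%:E (pos_part (psi n)) =
  ((\int[P]_t (pos_powR p (cos3_tuple t))%:E) `^ p^-1)%E.
Proof.
have <- := integral_cos3_affine i0 i1 i2 n (fun=> 0)
  (measurable_pos_powR p) (pos_powR_ge0 p).
rewrite torus_Lnorm_fin; congr (_ `^ _)%E; apply: eq_integral => t _.
by rewrite pos_partE psi_tuple ger0_norm// le_max lexx orbT.
Qed.

Lemma torus_Lnorm_psi_neg p n :
  torus_Lnorm p%:E (neg_part (psi n)) =
  ((\int[P]_t (pos_powR p (- cos3_tuple t))%:E) `^ p^-1)%E.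
Proof.
have <- := integral_cos3_affine i0 i1 i2 n (fun=> 0)
  (measurable_neg_pos_powR p) (fun x => pos_powR_ge0 p (- x)).
rewrite torus_Lnorm_fin; congr (_ `^ _)%E; apply: eq_integral => t _.
by rewrite neg_partE psi_tuple ger0_norm// le_max lexx orbT.
Qed.

Lemma torus_Lnorm_psi_neq p n : 1 < p ->
  torus_Lnorm p%:E (pos_part (psi n)) <> torus_Lnorm p%:E (neg_part (psi n)).
Proof.
move=> p1; rewrite torus_Lnorm_psi_pos torus_Lnorm_psi_neg => eq_norm.
have [] := elimF eqP (lt_eqF (integral_pos_powR_gt i01 i12 i20 p1)).
apply/esym; apply: poweRV_inj eq_norm.
- exact: lt_trans p1.
- by apply: integral_ge0 => t _; rewrite lee_fin pos_powR_ge0.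
- by apply: integral_ge0 => t _; rewrite lee_fin pos_powR_ge0.
Qed.

Lemma torus_LnormyE (f : 'rV[R]_d -> R) : torus_Lnorm +oo f =
  ess_sup P (fun t => `|f (\row_i tnth t i)|%:E).
Proof.
(* The norm at [+oo] is the essential supremum provided that the whole space has positive
   measure. *)
rewrite /torus_Lnorm unlock ifT//.
by rewrite (_ : (_ _ : \bar R) = 1%E) ?lte01//; exact: probability_setT.
Qed.

(** A smaller essential supremum would make a corner box on which [psi n > 2] negligible; its side
    shrinks with [n] but its measure stays positive. *)
Lemma torus_Lnormy_psi_pos_ge n : (2 <= torus_Lnorm +oo (pos_part (psi n)))%E.
Proof.
rewrite torus_LnormyE leNgt; apply/negP => lt2.
have [e e0 small] := @cos_sin_near0 R.
have N0 : 0 < pi *+ 2 * n.+1%:R :> R by rewrite mulr_gt0// mulrn_wgt0// pi_gt0.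
pose b := e / (pi *+ 2 * n.+1%:R).
have b0 : 0 < b by exact: divr_gt0.
have psi_gt2 t : corner_box d b t -> 2 < psi n (\row_i tnth t i).
  move=> tb; rewrite /psi.
  have tij i j : `|pi *+ 2 * (n.+1%:R * (\row_i tnth t i) ord0 i) -
      pi *+ 2 * (n.+1%:R * (\row_i tnth t i) ord0 j)| < e.
    rewrite !mxE !mulrA -mulrBr normrM (gtr0_norm N0) mulrC -ltr_pdivlMr//.
    have := tb i; have := tb j; rewrite !in_itv/= => /andP[? ?] /andP[? ?].
    by rewrite ltr_norml; apply/andP; split; rewrite -/b; lra.
  have [? ?] := small _ (tij i0 i1); have [? ?] := small _ (tij i1 i2).
  exact: cos3_gt2.
have [N [mN PN0 PN]] :=
  ess_sup_ge P (fun t => `|pos_part (psi n) (\row_i tnth t i)|%:E).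
have := corner_box_gt0 d b0; rewrite (subset_measure0 _ _ _ PN0) ?ltxx//.
  exact: measurable_corner_box.
move=> t tb; apply: PN => /= /(fun h => le_lt_trans h lt2).
rewrite lte_fin pos_partE; apply/negP; rewrite -leNgt.
by rewrite (le_trans _ (ler_norm _))// le_max ltW ?psi_gt2.
Qed.

Lemma torus_Lnormy_psi_neg_le n :
  (torus_Lnorm +oo (neg_part (psi n)) <= (3 / 2)%:E)%E.
Proof.
rewrite torus_LnormyE; apply/ess_supP; apply: nearW => t /=.
rewrite lee_fin neg_partE ger0_norm ?le_max ?lexx ?orbT// ge_max.
have : - (3 / 2) <= psi n (\row_i tnth t i) by exact: cos3_ge.
by move=> ?; apply/andP; split; lra.
Qed.

Lemma torus_Lnormy_psi_ratio_ge n :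
  ((4 / 3)%:E <= torus_Lnorm +oo (pos_part (psi n)) /
                torus_Lnorm +oo (neg_part (psi n)))%E.
Proof.
have := torus_Lnormy_psi_neg_le n; have := torus_Lnormy_psi_pos_ge n.
have : (0 <= torus_Lnorm +oo (neg_part (psi n)))%E by exact: Lnorm_ge0.
move: (torus_Lnorm _ (neg_part _)) (torus_Lnorm _ (pos_part _)) => x y x0 y2.
case: (inveP x) x0 => [|||r r0] //.
(* A zero denominator has inverse [+oo], which makes the ratio [+oo]. *)
- by rewrite gt0_muley ?leey// (lt_le_trans _ y2)// lte_fin.
- rewrite !lee_fin => r_ge0 r_le.
  have rgt0 : 0 < r by rewrite lt_neqAle eq_sym r0.
  rewrite lee_pdivlMr// (le_trans _ y2)// -EFinM lee_fin; lra.
Qed.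

(** For [p = +oo] the ratio stays above [4 / 3]. For finite [p] it is constant in [n], so its limit
    is its value at [n = 0], which differs from [1]. *)
Lemma psi_ratio_not_cvg1 p : (1 < p)%E ->
  ~ ((torus_Lnorm p (pos_part (psi n)) /
      torus_Lnorm p (neg_part (psi n)))%E @[n --> \oo] --> 1%E).
Proof.
case: p => [p| |] //; last first.
  move=> _ /(cvge_ge (nearW _ torus_Lnormy_psi_ratio_ge)).
  rewrite lee_fin; lra.
rewrite lte_fin => p1 ratio1; apply: (@torus_Lnorm_psi_neq p 0 p1).
apply: ereal_div_eq1; apply: cvg_unique ratio1.
  exact: ereal_hausdorff.
rewrite !torus_Lnorm_psi_pos !torus_Lnorm_psi_neg.
rewrite /=; under eq_cvg do rewrite torus_Lnorm_psi_pos torus_Lnorm_psi_neg.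
exact: cvg_cst.
Qed.

End torus_norms.

Theorem theorem4 (R : realType) (d : nat) (d_ge3 : (3 <= d)%N) :
  exists (psi : nat -> 'rV[R]_d -> R) (lambda : nat -> R),
    [/\ forall n : nat, torus_eigenfunction (lambda n) (psi n),
        lambda n @[n --> \oo] --> +oo
      & forall p : \bar R, (1 < p)%E ->
          ~ ((torus_Lnorm p (pos_part (psi n)) /
              torus_Lnorm p (neg_part (psi n)))%E @[n --> \oo] --> 1%E)].
Proof.
case: d d_ge3 => [|[|[|d]]]// _.
(* The assumption [3 <= d] provides three distinct coordinates. *)
pose i1 : 'I_d.+3 := lift ord0 ord0.
pose i2 : 'I_d.+3 := lift ord0 (lift ord0 ord0).
have [i01 i12 i20] : [/\ ord0 != i1, i1 != i2 & i2 != ord0] by [].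
exists (psi ord0 i1 i2), (fun n => 2 * (pi *+ 2 * n.+1%:R) ^+ 2); split.
- by move=> n; exact: psi_eigenfunction.
(* The eigenvalue dominates [n], because [2 pi (n + 1) >= n + 1]. *)
- apply: ger_cvgy cvgr_idn; apply: nearW => n /=.
  have le_t : n%:R + 1 <= pi *+ 2 * n.+1%:R :> R.
    by rewrite natr1 ler_peMl//; have := @pi_ge2 R; lra.
  by have := ler0n R n; nra.
- by move=> p p1; exact: psi_ratio_not_cvg1.
Qed.
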